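(* There is a ring isomorphism $$K_4\cong \mathbb{Z}[\alpha_2,\alpha_3,\alpha_4,\alpha_6]/(64\alpha_6-97\alpha_2^3-27\alpha_3^2+144\alpha_2\alpha_4),\qquad \alpha_i\in\Lambda_4^i .$$ That is, there exist elements $\alpha_i\in K_4\cap\Lambda_4^i$, $i=2,3,4,6$, such that the ring homomorphism $\mathbb{Z}[a_2,a_3,a_4,a_6]\to K_4$, $a_i\mapsto\alpha_i$, from the polynomial ring in four variables is surjective with kernel the principal ideal generated by $64a_6-97a_2^3-27a_3^2+144a_2a_4$.
   Context: $\Lambda_4=\mathbb{Z}[\sigma_1,\dots,\sigma_4]\subset\mathbb{Z}[v_1,\dots,v_4]$ is the ring of symmetric polynomials over $\mathbb{Z}$ in four variables, where $\sigma_i$ is the $i$th elementary symmetric polynomial, and $\Lambda_4^d\subset\Lambda_4$ is the $\mathbb{Z}$-submodule of symmetric polynomials homogeneous of degree $d$ (each $v_i$ having degree $1$). The operator $\nabla=\sum_{i=1}^4\partial/\partial v_i$ on $\mathbb{Z}[v_1,\dots,v_4]$ preserves $\Lambda_4$, and $K_4$ is the kernel of $\nabla:\Lambda_4\to\Lambda_4$. *)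

(* Defs.v *)
From HB Require Import structures.
From mathcomp Require Import all_boot all_order all_fingroup all_algebra.
From mathcomp Require Export mpoly.

Set Implicit Arguments.
Unset Strict Implicit.
Unset Printing Implicit Defensive.

Import GRing.Theory.
Local Open Scope ring_scope.

Definition mnabla (p : {mpoly int[4]}) : {mpoly int[4]} :=
  \sum_(i < 4) p^`M(i).

Lemma mnabla_is_linear : linear mnabla.
Proof.
move=> c p q; rewrite /mnabla scaler_sumr -big_split /=.
by apply: eq_bigr => i _; rewrite linearP.
Qed.

HB.instance Definition _ :=
  GRing.isLinear.Build int {mpoly int[4]} {mpoly int[4]} _ mnabla
    mnabla_is_linear.

Lemma mnablaM p q : mnabla (p * q) = mnabla p * q + p * mnabla q.
Proof.
rewrite /mnabla mulr_suml mulr_sumr -big_split /=.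
by apply: eq_bigr => i _; rewrite mderivM.
Qed.

Lemma mnabla1 : mnabla 1 = 0.
Proof. by rewrite /mnabla big1 // => i _; rewrite -mpolyC1 mderivC. Qed.

Lemma mnabla_msym s p : mnabla (msym s p) = msym s (mnabla p).
Proof.
elim/mpolyind: p => [|c m p _ _ ih]; first by rewrite !raddf0.
rewrite !(linearD, linearZ) /= ih; congr (_ *: _ + _).
rewrite msymX /mnabla raddf_sum /= (reindex_inj (@perm_inj _ s)) /=.
apply: eq_bigr => i _; rewrite !mderivX linearZ /= msymX mnmE permK.
congr (_ *: 'X_[_]); apply/mnmP => j; rewrite !mnmE.
by rewrite -[i in RHS](permK s) (inj_eq perm_inj).
Qed.

Lemma mnabla_sym p : p \is symmetric -> mnabla p \is symmetric.
Proof. by move=> /issymP sp; apply/issymP => s; rewrite -mnabla_msym sp. Qed.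

(* Permutation-invariant polynomials; by [sym_fundamental] these are exactly
   the polynomials in the elementary symmetric polynomials. *)
Record Lambda4 := MkLambda4 {
  Lambda4_val :> {mpoly int[4]};
  Lambda4_sym : Lambda4_val \in symmetric
}.

HB.instance Definition _ := [isSub for Lambda4_val].
HB.instance Definition _ := [Choice of Lambda4 by <:].
HB.instance Definition _ := [SubChoice_isSubComNzRing of Lambda4 by <:].

Definition nabla (p : Lambda4) : Lambda4 :=
  MkLambda4 (mnabla_sym (Lambda4_sym p)).

Definition ker_nabla : {pred Lambda4} := fun p => nabla p == 0.

Lemma ker_nablaE p : (p \in ker_nabla) = (mnabla (val p) == 0).
Proof. by rewrite unfold_in /ker_nabla -val_eqE. Qed.

Lemma ker_nabla_subring : subring_closed ker_nabla.
Proof.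
split=> [|p q|p q]; rewrite !ker_nablaE ?rmorph1 ?mnabla1 //.
  by rewrite rmorphB /= linearB /= => /eqP-> /eqP->; rewrite subr0.
by rewrite rmorphM /= mnablaM => /eqP-> /eqP->; rewrite mul0r mulr0 addr0.
Qed.

HB.instance Definition _ :=
  GRing.isSubringClosed.Build Lambda4 ker_nabla ker_nabla_subring.

Record K4 := MkK4 {
  K4_val :> Lambda4;
  K4_ker : K4_val \in ker_nabla
}.

HB.instance Definition _ := [isSub for K4_val].
HB.instance Definition _ := [Choice of K4 by <:].
HB.instance Definition _ := [SubChoice_isSubComNzRing of K4 by <:].

(* The ring morphism Z[a_2, a_3, a_4, a_6] -> K4 with a_i |-> alpha_i; the
   variables a_2, a_3, a_4, a_6 are numbered 0, 1, 2, 3. *)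
Definition evalK4 (alpha2 alpha3 alpha4 alpha6 : K4) :
    {rmorphism {mpoly int[4]} -> K4} :=
  mmap intr (tnth [tuple alpha2; alpha3; alpha4; alpha6]).

Definition a2 : {mpoly int[4]} := 'X_(@Ordinal 4 0 isT).
Definition a3 : {mpoly int[4]} := 'X_(@Ordinal 4 1 isT).
Definition a4 : {mpoly int[4]} := 'X_(@Ordinal 4 2 isT).
Definition a6 : {mpoly int[4]} := 'X_(@Ordinal 4 3 isT).

(* Main.v *)
Require Import Defs.
From HB Require Import structures.
From mathcomp Require Import all_boot all_order all_algebra.
From mathcomp Require Import ring zify.

Set Implicit Arguments.
Unset Strict Implicit.
Unset Printing Implicit Defensive.

Import GRing.Theory.
Local Open Scope ring_scope.

(** The generators are the seminvariants of the binary quartic whose roots are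
    the v_i. Writing s_i for the elementary symmetric polynomials, nabla sends
    s_1, s_2, s_3, s_4 to 4, 3 s_1, 2 s_2, s_3, and it kills
    A = 8 s_2 - 3 s_1^2 and B = s_1^3 - 4 s_1 s_2 + 8 s_3, as well as the
    classical I = 12 s_4 - 3 s_1 s_3 + s_2^2 and
    J = 2 s_2^3 - 9 s_1 s_2 s_3 + 27 s_3^2 + 27 s_1^2 s_4 - 72 s_2 s_4.
    They satisfy 64 J = A^3 + 27 B^2 - 48 A I. Since I = A^2 modulo 3, the
    polynomial C = (I + 2 A^2) / 3 is still integral; substituting
    I = 3 C - 2 A^2 turns the relation into
    64 J = 97 A^3 + 27 B^2 - 144 A C. The alpha_i are A, B, C and J.

    Away from 2 everything is easy. A, B, C and s_1 are algebraically
    independent, and together they generate every s_i up to a power of 2, so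
    2^N p is a polynomial in A, B, C and s_1 for each symmetric p. On such
    polynomials nabla is 4 times the partial derivative in s_1
    ([nabla_comp_invs_s1]), so when nabla p = 0 the variable s_1 does not occur
    and 2^N p is a polynomial in A, B and C. Likewise a polynomial vanishing at
    (A, B, C, J) can, after multiplication by a power of 64, be cleared of a_6
    using the relation, and what remains is zero by independence.

    What is left is to divide by 2. Modulo 2 the relation becomes
    a_2^3 + a_3^2, the equation of a cusp, and the key fact ([even_at_invs]) is
    that it generates all relations between A, B, C and J modulo 2. To see
    this, specialize (s_1, s_2, s_3, s_4) to (t, 0, t y, z + y^2): modulo 2 the
    four invariants become the monomials t^2, t^3, t^2 y and t^2 z, and distinct
    monomials in a_2, a_3, a_4, a_6 of degree at most 1 in a_3 go to distinct
    monomials in t, y, z. Hence if 2 g = F(A, B, C, J), then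
    F = Q * relation + 2 F', and g = F'(A, B, C, J). For the kernel, if 2 F is a
    multiple of the relation, then so is F, because the relation is nonzero
    modulo 2. *)

(** * Integral polynomials *)

Section IntegralPolynomials.
Variable n : nat.
Implicit Types p q : {mpoly int[n]}.

Lemma mpolyC_intr (c : int) : c%:MP_[n] = c%:~R.
Proof. by rewrite -[in LHS](intz c) rmorph_int. Qed.

Lemma mpoly_int_ind (P : {mpoly int[n]} -> Prop) :
  (forall c : int, P c%:~R) -> (forall i, P 'X_i) ->
  (forall p q, P p -> P q -> P (p + q)) ->
  (forall p q, P p -> P q -> P (p * q)) -> forall p, P p.
Proof.
move=> PC PX PD PM; elim/mpolyind => [|c m p _ _ Pp]; first exact: (PC 0).
apply: (PD) => //; rewrite -mul_mpolyC mpolyC_intr; apply: (PM) => //.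
rewrite mpolyXE_id; apply: big_ind => [||i _]; [exact: (PC 1) | exact: PM |].
by elim: (m i) => [|k IHk]; [exact: (PC 1) | rewrite exprS; exact: PM].
Qed.

Lemma mpoly_int_rmorph_eq (R : nzRingType)
    (f g : {rmorphism {mpoly int[n]} -> R}) :
  (forall i, f 'X_i = g 'X_i) -> f =1 g.
Proof.
move=> fg; elim/mpoly_int_ind => [c|i|p q fp fq|p q fp fq] //.
- by rewrite !rmorph_int.
- by rewrite !rmorphD fp fq.
- by rewrite !rmorphM fp fq.
Qed.

(** Clearing denominators: used with P a subring, to see that a subring which
    contains the variables up to powers of 2 contains everything up to powers
    of 2. *)
Lemma two_power_saturation (P : {mpoly int[n]} -> Prop) :
  (forall c : int, P c%:~R) ->
  (forall p q, P p -> P q -> P (p + q)) ->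
  (forall p q, P p -> P q -> P (p * q)) ->
  (forall i, exists N, P (2 ^+ N * 'X_i)) ->
  forall p, exists N, P (2 ^+ N * p).
Proof.
move=> PC PD PM PX.
have P2 k : P (2 ^+ k) by have := PC (2 ^+ k); rewrite rmorphXn.
apply: mpoly_int_ind => [c|//|p q [M Pp] [N Pq]|p q [M Pp] [N Pq]].
- by exists 0%N; rewrite mul1r.
- exists (M + N)%N.
  have -> : 2 ^+ (M + N) * (p + q) =
      2 ^+ N * (2 ^+ M * p) + 2 ^+ M * (2 ^+ N * q) by rewrite exprD; ring.
  by apply: PD; apply: PM.
- exists (M + N)%N.
  have -> : 2 ^+ (M + N) * (p * q) = (2 ^+ M * p) * (2 ^+ N * q).
    by rewrite exprD; ring.
  exact: PM.
Qed.

(** The exponent of the image of 'X_[m] when each variable 'X_i is replaced by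
    a scalar multiple of the monomial 'X_[w i]. *)
Definition monomial_subst (w : 'I_n -> 'X_{1..n}) (m : 'X_{1..n}) :=
  (\sum_(i < n) w i *+ m i)%MM.

(** No cancellation can occur in a monomial substitution at a monomial that
    comes from only one monomial of the support; this is how all algebraic
    independence statements below are obtained. *)
Lemma mcoeff_monomial_subst (l : n.-tuple {mpoly int[n]}) (u : 'I_n -> int)
    w p m :
  (forall i, tnth l i = u i *: 'X_[w i]) ->
  {in msupp p, forall k, monomial_subst w k = monomial_subst w m -> k = m} ->
  (p \mPo l)@_(monomial_subst w m) = p@_m * \prod_(i < n) u i ^+ m i.
Proof.
move=> lE inj_m.
have termE (k : 'X_{1..n}) : \prod_(i < n) tnth l i ^+ k i =
    (\prod_(i < n) u i ^+ k i) *: 'X_[monomial_subst w k].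
  rewrite /monomial_subst -mprodXnE -scaler_prod.
  by apply: eq_bigr => i _; rewrite lE exprZn.
rewrite comp_mpolyEX raddf_sum /=.
have [m_p|m_p] := boolP (m \in msupp p); last first.
  rewrite (memN_msupp_eq0 m_p) mul0r big_seq big1 // => k k_p.
  rewrite comp_mpolyX termE !mcoeffZ mcoeffX.
  case: eqP => [/(inj_m _ k_p) km|]; last by rewrite !mulr0.
  by rewrite -km k_p in m_p.
rewrite (bigD1_seq m) //= big_seq_cond big1 => [|k /andP[k_p nkm]].
  by rewrite comp_mpolyX termE !mcoeffZ mcoeffX eqxx mulr1 addr0.
rewrite comp_mpolyX termE !mcoeffZ mcoeffX.
case: eqP => [/(inj_m _ k_p) km|]; last by rewrite !mulr0.
by rewrite km eqxx in nkm.
Qed.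

Lemma mpoly_two_inj : injective (fun p => 2 * p).
Proof.
move=> p q /= /(mulfI _); apply.
by rewrite -(rmorph_nat (@mpolyC n int)) mpolyC_eq0.
Qed.

Definition mod2 : {mpoly int[n]} -> {mpoly 'F_2[n]} := map_mpoly intr.
HB.instance Definition _ := GRing.RMorphism.on mod2.

Lemma mcoeff_mod2 p m : (mod2 p)@_m = (p@_m)%:~R.
Proof. exact: mcoeff_map_mpoly. Qed.

Lemma mod2_eq0P p : mod2 p = 0 -> exists q, p = 2 * q.
Proof.
move=> p0; exists (\sum_(m <- msupp p) (p@_m %/ 2)%Z *: 'X_[m]).
rewrite [LHS]mpolyE mulr_sumr; apply: eq_bigr => m _.
rewrite mulr_natl scalerMnl; congr (_ *: _).
have := mcoeff_mod2 p m; rewrite p0 mcoeff0 => /esym/eqP.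
rewrite -(dvdz_pcharf (pchar_Fp (erefl (prime 2)))) => d2.
by rewrite -mulr_natr natz divzK.
Qed.

Lemma mod2_double p : mod2 (2 * p) = 0.
Proof.
apply/mpolyP => m; rewrite mcoeff0 mcoeff_mod2 mulr_natl mcoeffMn.
by rewrite rmorphMn /= -mulr_natr (pchar_Fp_0 (p := 2)) ?mulr0.
Qed.

End IntegralPolynomials.

(** * The four invariants and their relation *)

Section Invariants.
Variable R : comNzRingType.
Implicit Types s : R.

Definition inv2 s1 s2 := 8%:R * s2 - 3%:R * s1 ^+ 2.

Definition inv3 s1 s2 s3 := s1 ^+ 3 - 4%:R * s1 * s2 + 8%:R * s3.

(** This is (I + 2 A^2) / 3, where I = 12 s4 - 3 s1 s3 + s2^2 is the quadratic
    invariant of the binary quartic and A = inv2 s1 s2. *)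
Definition inv4 s1 s2 s3 s4 :=
  43%:R * s2 ^+ 2 - 32%:R * s1 ^+ 2 * s2 + 6%:R * s1 ^+ 4
  + 4%:R * s4 - s1 * s3.

(** The cubic invariant of the binary quartic, up to sign. *)
Definition inv6 s1 s2 s3 s4 :=
  2%:R * s2 ^+ 3 - 9%:R * s1 * s2 * s3 + 27%:R * s3 ^+ 2
  + 27%:R * s1 ^+ 2 * s4 - 72%:R * s2 * s4.

Lemma inv_relation s1 s2 s3 s4 :
  64%:R * inv6 s1 s2 s3 s4 =
  97%:R * inv2 s1 s2 ^+ 3 + 27%:R * inv3 s1 s2 s3 ^+ 2
  - 144%:R * inv2 s1 s2 * inv4 s1 s2 s3 s4.
Proof. by rewrite /inv6 /inv2 /inv3 /inv4; ring. Qed.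

End Invariants.

Section InvariantsMorphism.
Variables (R S : comNzRingType) (f : {rmorphism R -> S}).
Let rmorphE := (rmorph_nat, rmorphXn, rmorphM, rmorphB, rmorphD).

Lemma rmorph_inv2 s1 s2 : f (inv2 s1 s2) = inv2 (f s1) (f s2).
Proof. by rewrite /inv2 !rmorphE. Qed.

Lemma rmorph_inv3 s1 s2 s3 : f (inv3 s1 s2 s3) = inv3 (f s1) (f s2) (f s3).
Proof. by rewrite /inv3 !rmorphE. Qed.

Lemma rmorph_inv4 s1 s2 s3 s4 :
  f (inv4 s1 s2 s3 s4) = inv4 (f s1) (f s2) (f s3) (f s4).
Proof. by rewrite /inv4 !rmorphE. Qed.

Lemma rmorph_inv6 s1 s2 s3 s4 :
  f (inv6 s1 s2 s3 s4) = inv6 (f s1) (f s2) (f s3) (f s4).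
Proof. by rewrite /inv6 !rmorphE. Qed.

End InvariantsMorphism.

Local Notation o4 i := (@Ordinal 4 i isT) (only parsing).
Local Notation Z4 := {mpoly int[4]}.
Local Notation x4 i := ('X_(@Ordinal 4 i isT) : Z4).

Lemma forall_ord4 (P : 'I_4 -> Prop) :
  P (o4 0) -> P (o4 1) -> P (o4 2) -> P (o4 3) -> forall i, P i.
Proof.
move=> P0 P1 P2 P3 [[|[|[|[|k]]]] lt_k] //;
  by rewrite (bool_irrelevance lt_k isT).
Qed.

Lemma sum_ord4 (F : 'I_4 -> nat) :
  (\sum_(i < 4) F i = F (o4 0) + F (o4 1) + F (o4 2) + F (o4 3))%N.
Proof.
rewrite !big_ord_recl big_ord0 addn0 !addnA.
by congr (F _ + F _ + F _ + F _)%N; apply: val_inj.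
Qed.

Lemma comp_mpolyA (p : Z4) (l k : 4.-tuple Z4) :
  (p \mPo l) \mPo k = p \mPo [tuple tnth l i \mPo k | i < 4].
Proof.
apply: (mpoly_int_rmorph_eq (f := comp_mpoly k \o comp_mpoly l)) => i /=.
by rewrite !comp_mpolyXU -!tnth_nth tnth_mktuple.
Qed.

Lemma mod2_comp p (l l' : 4.-tuple Z4) :
  (forall i, mod2 (tnth l i) = mod2 (tnth l' i)) ->
  mod2 (p \mPo l) = mod2 (p \mPo l').
Proof.
move=> ll'; apply: (mpoly_int_rmorph_eq
  (f := @mod2 4 \o comp_mpoly l) (g := @mod2 4 \o comp_mpoly l')) => i /=.
by rewrite !comp_mpolyXU -!tnth_nth.
Qed.

(** The invariants as elements of the polynomial ring Z[s_1, ..., s_4], which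
    is isomorphic to Lambda_4 and where s_1, ..., s_4 can be specialized
    freely. *)
Definition invs : 4.-tuple Z4 :=
  [tuple inv2 (x4 0) (x4 1); inv3 (x4 0) (x4 1) (x4 2);
         inv4 (x4 0) (x4 1) (x4 2) (x4 3); inv6 (x4 0) (x4 1) (x4 2) (x4 3)].

(** The coordinates A, B, C, s_1: as s_1 comes last, polynomials not involving
    the last variable take the same value at [invs] and at [invs_s1]. *)
Definition invs_s1 : 4.-tuple Z4 :=
  [tuple inv2 (x4 0) (x4 1); inv3 (x4 0) (x4 1) (x4 2);
         inv4 (x4 0) (x4 1) (x4 2) (x4 3); x4 0].

Definition syz : Z4 :=
  64%:R * a6 - 97%:R * a2 ^+ 3 - 27%:R * a3 ^+ 2 + 144%:R * a2 * a4.

Lemma syz_invs : syz \mPo invs = 0.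
Proof.
rewrite /syz /a2 /a3 /a4 /a6 !(rmorphB, rmorphD) !rmorphM !rmorph_nat /=.
rewrite !comp_mpolyXU /= inv_relation; ring.
Qed.

(** * Away from the prime 2 *)

(** After a substitution of the s_i, the polynomials A, B, C, s_1 become
    16 x_0, 8 x_1, 4 x_2, 8 x_3. *)
Lemma invs_s1_free p : p \mPo invs_s1 = 0 -> p = 0.
Proof.
(* With s_1 = 8 x_3 the equations A = 16 x_0, B = 8 x_1, C = 4 x_2 are solved
   successively for s_2, s_3, s_4; these multiples keep the solution
   integral. *)
pose s2 : Z4 := 24%:R * x4 3 ^+ 2 + 2%:R * x4 0.
pose s3 : Z4 := x4 1 - 64%:R * x4 3 ^+ 3 + 4%:R * x4 3 * s2.
pose s4 : Z4 := x4 2 - 43%:R * (12%:R * x4 3 ^+ 2 + x4 0) ^+ 2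
  + 512%:R * x4 3 ^+ 2 * s2 - 6144%:R * x4 3 ^+ 4 + 2%:R * x4 3 * s3.
pose k : 4.-tuple Z4 := [tuple 8%:R * x4 3; s2; s3; s4].
pose u (i : 'I_4) : int := [tuple 16; 8; 4; 8]`_i.
pose w (i : 'I_4) : 'X_{1..4} := U_(i)%MM.
move=> p0; apply/mpolyP => m; rewrite mcoeff0.
have := mcoeff_monomial_subst (l := [tuple tnth invs_s1 i \mPo k | i < 4])
  (u := u) (w := w) (p := p) (m := m).
have wE (j : 'X_{1..4}) : monomial_subst w j = j.
  by apply/mnmP => i; rewrite [in RHS](multinomUE_id j) mnm_sumE.
rewrite -comp_mpolyA p0 comp_mpoly0 mcoeff0 => /(_ _ _)/esym/eqP.
rewrite mulf_eq0 prodf_seq_eq0; case/(_ _ _)/orP => [||/eqP //|].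
- apply: forall_ord4; rewrite tnth_mktuple (tnth_nth 0) /u /=
    -mul_mpolyC mpolyC_intr -?pmulrn.
  + rewrite rmorph_inv2 /= !comp_mpolyXU /= /inv2 /s2; ring.
  + rewrite rmorph_inv3 /= !comp_mpolyXU /= /inv3 /s3; ring.
  + rewrite rmorph_inv4 /= !comp_mpolyXU /= /inv4 /s4 /s2; ring.
  + by rewrite comp_mpolyXU.
- by move=> j _; rewrite !wE.
- by case/hasP => i _; rewrite /= expf_eq0; elim/forall_ord4: i; rewrite andbF.
Qed.

Lemma invs_s1_span p : exists N r, 2 ^+ N * p = r \mPo invs_s1.
Proof.
apply: (two_power_saturation (P := fun p => exists r, p = r \mPo invs_s1)).
- by move=> c; exists c%:~R; rewrite rmorph_int.
- by move=> _ _ [r ->] [r' ->]; exists (r + r'); rewrite rmorphD.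
- by move=> _ _ [r ->] [r' ->]; exists (r * r'); rewrite rmorphM.
have [r2 E2] : exists r, 8%:R * x4 1 = r \mPo invs_s1.
  exists (x4 0 + 3%:R * x4 3 ^+ 2).
  rewrite rmorphD !rmorphM !rmorph_nat /= !comp_mpolyXU /= /inv2; ring.
have [r3 E3] : exists r, 16%:R * x4 2 = r \mPo invs_s1.
  exists (2%:R * x4 1 - 2%:R * x4 3 ^+ 3 + x4 3 * r2).
  rewrite !(rmorphB, rmorphD) !rmorphM !rmorph_nat /= -E2 !comp_mpolyXU /=.
  rewrite /inv3; ring.
apply: forall_ord4.
- by exists 0%N, (x4 3); rewrite /= comp_mpolyXU mul1r.
- by exists 3%N, r2; rewrite -E2; ring.
- by exists 4%N, r3; rewrite -E3; ring.
exists 8%N, (64%:R * x4 2 - 43%:R * r2 ^+ 2 + 256%:R * x4 3 ^+ 2 * r2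
  - 384%:R * x4 3 ^+ 4 + 4%:R * x4 3 * r3).
rewrite !(rmorphB, rmorphD) !rmorphM !rmorph_nat /= -E2 -E3 !comp_mpolyXU /=.
rewrite /inv4; ring.
Qed.

Definition no_a6 : 4.-tuple Z4 := [tuple x4 0; x4 1; x4 2; 0].

Lemma no_a6_invs p : (p \mPo no_a6) \mPo invs = (p \mPo no_a6) \mPo invs_s1.
Proof.
rewrite 2!(comp_mpolyA p no_a6); congr (p \mPo _); apply: eq_from_tnth.
apply: forall_ord4; rewrite !tnth_mktuple !(tnth_nth 0) /= ?comp_mpolyXU //.
by rewrite !comp_mpoly0.
Qed.

Lemma elim_a6 (p : Z4) :
  exists N q r, 2 ^+ N * p = q * syz + (r \mPo no_a6).
Proof.
apply: (two_power_saturation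
  (P := fun p => exists q r, p = q * syz + (r \mPo no_a6))).
- by move=> c; exists 0, c%:~R; rewrite rmorph_int mul0r add0r.
- move=> _ _ [q [r ->]] [q' [r' ->]]; exists (q + q'), (r + r').
  by rewrite rmorphD /= mulrDl addrACA.
- move=> _ _ [q [r ->]] [q' [r' ->]].
  exists (q * (q' * syz + (r' \mPo no_a6)) + (r \mPo no_a6) * q'), (r * r').
  by rewrite rmorphM /=; move: (r \mPo _) (r' \mPo _) => s s'; ring.
apply: forall_ord4.
- by exists 0%N, 0, (x4 0); rewrite comp_mpolyXU mul0r add0r mul1r.
- by exists 0%N, 0, (x4 1); rewrite comp_mpolyXU mul0r add0r mul1r.
- by exists 0%N, 0, (x4 2); rewrite comp_mpolyXU mul0r add0r mul1r.
exists 6%N, 1, (97%:R * x4 0 ^+ 3 + 27%:R * x4 1 ^+ 2 - 144%:R * x4 0 * x4 2).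
rewrite !(rmorphB, rmorphD) !rmorphM !rmorph_nat /= !comp_mpolyXU /=.
rewrite /syz /a2 /a3 /a4 /a6; ring.
Qed.

(** * Dividing by 2 *)

(** Division by a3^2 + a2^3, which is monic in a3. *)
Lemma reduce_mod_cusp (p : Z4) :
  exists q r, p = q * (a3 ^+ 2 + a2 ^+ 3) + r /\
  {in msupp r, forall m : 'X_{1..4}, (m (o4 1) <= 1)%N}.
Proof.
elim/mpolyind: p => [|c m p _ _ [q [r [-> r1]]]].
  by exists 0, 0; rewrite mul0r addr0; split=> // m; rewrite msupp0.
suff [q' [r' [-> r1']]] : exists q r, 'X_[m] = q * (a3 ^+ 2 + a2 ^+ 3) + r /\
    {in msupp r, forall m : 'X_{1..4}, (m (o4 1) <= 1)%N}.
  exists (c *: q' + q), (c *: r' + r); split.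
    by rewrite scalerDr mulrDl scalerAl addrACA.
  move=> k /msuppD_le; rewrite mem_cat => /orP[/msuppZ_le|].
    exact: r1'.
  exact: r1.
have [b] := ubnP (m (o4 1)); elim: b m => // b IHb m le_mb.
have [m1|m1] := leqP (m (o4 1)) 1.
  exists 0, 'X_[m]; rewrite mul0r add0r; split=> // k.
  by rewrite msuppX inE => /eqP->.
pose m' := (m - U_(o4 1) *+ 2)%MM.
have mE : m = (m' + U_(o4 1) *+ 2)%MM.
  rewrite /m' submK //; apply/mnm_lepP; apply: forall_ord4;
    by rewrite mulmnE mnmE.
have [|q' [r' [Eq r1']]] := IHb (m' + U_(o4 0) *+ 3)%MM.
  by rewrite /m' !mnmE /=; lia.
exists ('X_[m'] - q'), (- r'); split; last first.
  by move=> k; rewrite (perm_mem (msuppN _)); apply: r1'.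
have -> : 'X_[m] =
    'X_[m'] * (a3 ^+ 2 + a2 ^+ 3) - 'X_[m' + U_(o4 0) *+ 3].
  by rewrite {1}mE !mpolyXD /a2 /a3; ring.
rewrite Eq; ring.
Qed.

(** Modulo 2, [syz] is the cusp equation up to sign, so p may be replaced by its
    remainder r; the monomial specialization then forces r to be even. *)
Lemma even_at_invs p g : p \mPo invs = 2 * g -> exists q r, p = q * syz + 2 * r.
Proof.
have [q [r [-> r1]]] := reduce_mod_cusp p.
have cuspE : a3 ^+ 2 + a2 ^+ 3 = 2 * (32%:R * a6 - 48%:R * a2 ^+ 3
    - 13%:R * a3 ^+ 2 + 72%:R * a2 * a4) - syz by rewrite /syz; ring.
set c := _ - _ + _ in cuspE; rewrite cuspE => Ep.
(* The specialization (t, 0, t y, z + y^2) of (s_1, s_2, s_3, s_4), and the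
   exponents w of the monomials t^2, t^3, t^2 y, t^2 z that A, B, C, J become
   modulo 2. *)
pose k : 4.-tuple Z4 := [tuple x4 0; 0; x4 0 * x4 1; x4 2 + x4 1 ^+ 2].
pose w (i : 'I_4) : 'X_{1..4} :=
  nth 0%MM [:: U_(o4 0) *+ 2; U_(o4 0) *+ 3; U_(o4 0) *+ 2 + U_(o4 1);
               U_(o4 0) *+ 2 + U_(o4 2)]%MM i.
have rE : r \mPo invs = 2 * (g - (q \mPo invs) * (c \mPo invs)).
  have evE (a b : Z4) : (q * (2 * a - b) + r) \mPo invs =
      (q \mPo invs) * (2 * (a \mPo invs) - (b \mPo invs)) + (r \mPo invs).
    by rewrite rmorphD rmorphM rmorphB rmorphM rmorph_nat.
  rewrite mulrBr -Ep evE syz_invs.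
  by move: (_ \mPo _) (q \mPo _) (c \mPo _) => r' q' c'; ring.
have : mod2 (r \mPo [tuple 'X_[w i] | i < 4]) = 0.
  rewrite -(mod2_comp _ (l := [tuple tnth invs i \mPo k | i < 4])).
    by rewrite -comp_mpolyA rE rmorphM rmorph_nat mod2_double.
  have mod2P (a b d : Z4) : a = b + 2 * d -> mod2 a = mod2 b.
    by move=> ->; rewrite rmorphD /= mod2_double addr0.
  apply: forall_ord4; rewrite !tnth_mktuple (tnth_nth 0) /w /= ?mpolyXD.
  - apply: (mod2P _ _ (- 2 * x4 0 ^+ 2)).
    by rewrite rmorph_inv2 /= !comp_mpolyXU /= /inv2; ring.
  - apply: (mod2P _ _ (4 * x4 0 * x4 1)).
    by rewrite rmorph_inv3 /= !comp_mpolyXU /= /inv3; ring.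
  - apply: (mod2P _ _
      (2 * (x4 2 + x4 1 ^+ 2) - x4 0 ^+ 2 * x4 1 + 3 * x4 0 ^+ 4)).
    by rewrite rmorph_inv4 /= !comp_mpolyXU /= /inv4; ring.
  - apply: (mod2P _ _ (13 * x4 0 ^+ 2 * x4 2 + 27 * x4 0 ^+ 2 * x4 1 ^+ 2)).
    rewrite rmorph_inv6 /= !comp_mpolyXU /= /inv6.
    by move: (x4 0) (x4 1) (x4 2) => t y z; ring.
case/mod2_eq0P => h rh; suff /mod2_eq0P[h' rh'] : mod2 r = 0.
  by exists (- q), (q * c + h'); rewrite {1}rh'; ring.
apply/mpolyP => m; rewrite mcoeff0 mcoeff_mod2.
have [m_r|m_r] := boolP (m \in msupp r); last first.
  by rewrite (memN_msupp_eq0 m_r).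
have coefE := mcoeff_monomial_subst (l := [tuple 'X_[w i] | i < 4])
  (u := fun=> 1) (w := w) (p := r) (m := m).
have -> : r@_m = (2 * h)@_(monomial_subst w m).
  rewrite -rh coefE; first by rewrite big1 ?mulr1 // => i _; rewrite expr1n.
    by move=> i; rewrite tnth_mktuple scale1r.
  (* The exponents of y and z are those of a4 and a6; the exponent of t then
     gives 2 m_0 + 3 m_1, whose parity is m_1 as m_1 is 0 or 1. *)
  move=> m' m'_r /mnmP mm'; apply/mnmP.
  have wE j (d : 'X_{1..4}) : monomial_subst w d j =
      (w (o4 0) j * d (o4 0) + w (o4 1) j * d (o4 1) + w (o4 2) j * d (o4 2)
       + w (o4 3) j * d (o4 3))%N.
    by rewrite mnm_sumE sum_ord4 !mulmnE.
  have := (mm' (o4 0), mm' (o4 1), mm' (o4 2)).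
  have := (r1 _ m_r, r1 _ m'_r).
  rewrite !wE /w /= !mnmE /= => -[? ?] [[? ?] ?].
  by apply: forall_ord4; lia.
by rewrite -mcoeff_mod2 mod2_double mcoeff0.
Qed.

Lemma invs_descend N p r :
  2 ^+ N * p = r \mPo invs -> exists r', p = r' \mPo invs.
Proof.
elim: N r => [|N IHN] r; first by rewrite mul1r; exists r.
rewrite exprS -mulrA => E; have [q [r' Er]] := even_at_invs (esym E).
apply: (IHN r'); apply: (@mpoly_two_inj 4) => /=; rewrite E Er.
have evE (a b : Z4) : (q * a + 2 * b) \mPo invs =
    (q \mPo invs) * (a \mPo invs) + 2 * (b \mPo invs).
  by rewrite rmorphD !rmorphM rmorph_nat.
by rewrite evE syz_invs mulr0 add0r.
Qed.

Lemma mod2_syz_neq0 : mod2 syz != 0.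
Proof.
apply/eqP => /mod2_eq0P[h].
(* The value of syz at (1, 0, 0, 0) is odd. *)
move/(congr1 (meval (tnth [tuple 1; 0; 0; 0]))).
rewrite rmorphM rmorph_nat /=; set v := tnth _; move: (meval v h) => z.
have -> : syz.@[v] = - 97.
  rewrite /syz /a2 /a3 /a4 /a6 rmorphD !rmorphB.
  rewrite !(rmorphM, rmorphXn, rmorph_nat) /=.
  by rewrite !mevalXU /v !(tnth_nth 0) /=; ring.
lia.
Qed.

Lemma syz_div2 f q : 2 * f = q * syz -> exists q', f = q' * syz.
Proof.
move=> E; have /(congr1 (@mod2 4)) := E.
rewrite mod2_double rmorphM /= => /esym/eqP.
rewrite mulf_eq0 => /orP[/eqP/mod2_eq0P[q' Eq]|syz0]; last first.
  by case/negP: mod2_syz_neq0.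
exists q'; apply: (@mpoly_two_inj 4) => /=; rewrite E Eq; ring.
Qed.

Lemma invs_ker p : p \mPo invs = 0 -> exists q, p = q * syz.
Proof.
have [N [q [r E]]] := elim_a6 p; move=> p0.
have r0 : r \mPo no_a6 = 0.
  apply: invs_s1_free; rewrite -no_a6_invs.
  have /(congr1 (comp_mpoly invs)) := E.
  by rewrite rmorphM /= p0 mulr0 rmorphD rmorphM /= syz_invs mulr0 add0r.
rewrite r0 addr0 in E.
elim: N q E {p0} => [|N IHN] q E; first by exists q; rewrite -E mul1r.
by rewrite exprS -mulrA in E; have [q' /IHN] := syz_div2 E.
Qed.

(** * The operator nabla on elementary symmetric polynomials *)

(** A square-free monomial of degree k arises by differentiation from exactly
    the n - k square-free monomials with one more variable. *)
Lemma sum_mderiv_mesym (n : nat) (R : comNzRingType) k :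
  \sum_(i < n) (mesym n R k.+1)^`M(i) = (n - k)%:R * mesym n R k.
Proof.
apply/mpolyP => m; rewrite raddf_sum mulr_natl mcoeffMn mcoeff_mesym /=.
have mecharS i : mechar k.+1 (m + U_(i))%MM = mechar k m && (m i == 0%N).
  rewrite /mechar mdegD mdeg1 addn1 eqSS -andbA; congr (_ && _).
  apply/forallP/andP => [m1|[/forallP m1 /eqP mi] j].
    have mi : m i = 0%N by have := m1 i; rewrite !mnmE eqxx; lia.
    split; last by rewrite mi.
    by apply/forallP => j; have := m1 j; rewrite !mnmE; lia.
  by have := m1 j; rewrite !mnmE; case: eqP => [<-|_]; rewrite ?mi ?addn0.
have coefE i : (mesym n R k.+1)^`M(i)@_m = (mechar k m && (m i == 0%N))%:R.
  rewrite mcoeff_mderiv mcoeff_mesym mecharS.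
  by case: eqP => [->|]; rewrite ?andbF ?mul0rn.
under eq_bigr => i _ do rewrite coefE.
rewrite -natr_sum -mulrnA; congr (_%:R).
have [/andP[/eqP mk /forallP m1]|] := boolP (mechar k m); last first.
  by rewrite mul0n big1.
suff : (\sum_(i < n) (m i == 0%N) + k)%N = n by rewrite mul1n /=; lia.
rewrite -mk mdegE -big_split /= -[RHS]card_ord -sum1_card.
by apply: eq_bigr => i _; have := m1 i; case: (m i) => [|[|]].
Qed.

Local Notation sig k := (mesym 4 int k).

Definition sigmas : 4.-tuple Z4 := [tuple sig i.+1 | i < 4].

Lemma mnabla_mesym k : mnabla (sig k.+1) = (4 - k)%:R * sig k.
Proof. exact: sum_mderiv_mesym. Qed.

Lemma mnabla_nat n : mnabla n%:R = 0.
Proof. by rewrite raddfMn /= mnabla1 mul0rn. Qed.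

Lemma mnabla_int (c : int) : mnabla c%:~R = 0.
Proof. by rewrite raddfMz /= mnabla1 mul0rz. Qed.

Lemma comp_sigmas (i : 'I_4) : 'X_i \mPo sigmas = sig i.+1.
Proof. by rewrite comp_mpolyXU -tnth_nth tnth_mktuple. Qed.

Lemma invs_sigmas :
  [/\ tnth invs (o4 0) \mPo sigmas = inv2 (sig 1) (sig 2),
      tnth invs (o4 1) \mPo sigmas = inv3 (sig 1) (sig 2) (sig 3),
      tnth invs (o4 2) \mPo sigmas = inv4 (sig 1) (sig 2) (sig 3) (sig 4)
    & tnth invs (o4 3) \mPo sigmas = inv6 (sig 1) (sig 2) (sig 3) (sig 4)].
Proof.
split; rewrite (tnth_nth 0) /=.
- by rewrite rmorph_inv2 /= !comp_sigmas.
- by rewrite rmorph_inv3 /= !comp_sigmas.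
- by rewrite rmorph_inv4 /= !comp_sigmas.
- by rewrite rmorph_inv6 /= !comp_sigmas.
Qed.

Lemma mnabla_invs i : mnabla (tnth invs i \mPo sigmas) = 0.
Proof.
case: invs_sigmas => E0 E1 E2 E3.
suff [? ? ? ?] : [/\ mnabla (inv2 (sig 1) (sig 2)) = 0,
    mnabla (inv3 (sig 1) (sig 2) (sig 3)) = 0,
    mnabla (inv4 (sig 1) (sig 2) (sig 3) (sig 4)) = 0
  & mnabla (inv6 (sig 1) (sig 2) (sig 3) (sig 4)) = 0].
  by elim/forall_ord4: i; rewrite (E0, E1, E2, E3).
rewrite /inv2 /inv3 /inv4 /inv6 !(raddfB, raddfD) /=.
have n1 : mnabla (sig 1) = 4%:R by rewrite mnabla_mesym mesym0E mulr1.
have n2 : mnabla (sig 2) = 3%:R * sig 1 by rewrite mnabla_mesym.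
have n3 : mnabla (sig 3) = 2%:R * sig 2 by rewrite mnabla_mesym.
have n4 : mnabla (sig 4) = sig 3 by rewrite mnabla_mesym mul1r.
rewrite !(mnablaM, mnabla_nat, n1, n2, n3, n4).
move: {n1 n2 n3 n4} (sig 1) (sig 2) (sig 3) (sig 4) => e1 e2 e3 e4 /=.
by split; ring.
Qed.

(** The chain rule: nabla kills A, B, C and sends s_1 to 4. *)
Lemma nabla_comp_invs_s1 p : mnabla ((p \mPo invs_s1) \mPo sigmas) =
  4%:R * ((p^`M(o4 3) \mPo invs_s1) \mPo sigmas).
Proof.
elim/mpoly_int_ind: p => [c|i|p q IHp IHq|p q IHp IHq].
- by rewrite !rmorph_int mnabla_int -mpolyC_intr mderivC !comp_mpoly0 mulr0.
- rewrite comp_mpolyXU -tnth_nth mderivX mnmE.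
  elim/forall_ord4: i; rewrite /= ?scale0r ?comp_mpoly0 ?mulr0.
  + exact: (mnabla_invs (o4 0)).
  + exact: (mnabla_invs (o4 1)).
  + exact: (mnabla_invs (o4 2)).
  have -> : (U_(o4 3) - U_(o4 3) = 0 :> 'X_{1..4})%MM.
    by apply/mnmP => j; rewrite !mnmE subnn.
  by rewrite scale1r mpolyX0 !comp_mpoly1 comp_sigmas mnabla_mesym mesym0E.
- by rewrite mderivD !(comp_mpolyD, raddfD) /= IHp IHq mulrDr.
- have evM (a b : Z4) : (a * b \mPo invs_s1) \mPo sigmas =
      ((a \mPo invs_s1) \mPo sigmas) * ((b \mPo invs_s1) \mPo sigmas).
    exact: (rmorphM (comp_mpoly sigmas \o comp_mpoly invs_s1)).
  rewrite evM mnablaM IHp IHq mderivM !comp_mpolyD !evM.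
  by move: (_ \mPo _) (_ \mPo _) (_ \mPo _) (_ \mPo _) => a b c d; ring.
Qed.

Lemma mderiv0_no_a6 (p : Z4) : p^`M(o4 3) = 0 -> p = p \mPo no_a6.
Proof.
move=> p0; have m3 m : m \in msupp p -> m (o4 3) = 0%N.
  rewrite mcoeff_msupp; apply: contraNeq => m3.
  have := congr1 (mcoeff (m - U_(o4 3))) p0.
  rewrite mcoeff_mderiv mcoeff0 submK; last first.
    by apply/mnm_lepP => j; rewrite mnmE; case: eqP => // <-; rewrite lt0n.
  by move/eqP; rewrite -mulr_natr mulf_eq0 Num.Theory.pnatr_eq0 orbF.
rewrite [LHS]mpolyE comp_mpolyEX; apply: eq_big_seq => m /m3 m0.
rewrite comp_mpolyX mpolyXE_id; congr (_ *: _); apply: eq_bigr => i _.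
by elim/forall_ord4: i => //; rewrite m0 !expr0.
Qed.

Lemma ker_nabla_invs p :
  mnabla (p \mPo sigmas) = 0 -> exists r, p = r \mPo invs.
Proof.
have [N [r E]] := invs_s1_span p => p0.
suff r0 : r^`M(o4 3) = 0.
  apply: (@invs_descend N p (r \mPo no_a6)).
  by rewrite no_a6_invs -mderiv0_no_a6.
apply/invs_s1_free/msym_fundamental_un0; apply/eqP.
have /eqP := nabla_comp_invs_s1 r.
rewrite -E rmorphM rmorphXn rmorph_nat mnablaM p0 mulr0 addr0.
rewrite -natrX mnabla_nat mul0r eq_sym mulf_eq0.
by rewrite -(rmorph_nat (@mpolyC 4 int)) mpolyC_eq0.
Qed.

(** * The generators of K_4 *)

Lemma comp_sigmas_sym p : p \mPo sigmas \in mpoly.symmetric.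
Proof.
by apply: mcomp_sym => i; rewrite -tnth_nth tnth_mktuple; exact: mesym_sym.
Qed.

Definition Lambda4_of p := MkLambda4 (comp_sigmas_sym p).

Lemma Lambda4_of_ker p :
  mnabla (p \mPo sigmas) = 0 -> Lambda4_of p \in ker_nabla.
Proof. by move=> p0; rewrite ker_nablaE /= p0. Qed.

Definition alpha i : K4 := MkK4 (Lambda4_of_ker (mnabla_invs i)).

Lemma evalK4_alpha p :
  val (val (evalK4 (alpha (o4 0)) (alpha (o4 1)) (alpha (o4 2)) (alpha (o4 3))
    p)) = (p \mPo invs) \mPo sigmas.
Proof.
pose f := evalK4 (alpha (o4 0)) (alpha (o4 1)) (alpha (o4 2)) (alpha (o4 3)).
pose val2 : {rmorphism K4 -> Z4} :=
  (val : Lambda4 -> Z4) \o (val : K4 -> Lambda4).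
apply: (mpoly_int_rmorph_eq
  (f := val2 \o f) (g := comp_mpoly sigmas \o comp_mpoly invs)).
move=> i /=; rewrite mmapX mmap1U comp_mpolyXU -tnth_nth.
by elim/forall_ord4: i.
Qed.

Lemma dhomog_nat n : (n%:R : Z4) \is 0.-homog.
Proof. by apply: rpredMn; exact: dhomog1. Qed.

Lemma dhomog_cast d d' (p : Z4) : p \is d.-homog -> d = d' -> p \is d'.-homog.
Proof. by move=> ? <-. Qed.

Ltac homog_monomial := apply: dhomog_cast;
  [repeat first [exact: dhomog_mesym | exact: dhomog_nat
     | apply: dhomogMn | apply: dhomogM] | reflexivity].

Lemma alpha_homog :
  [/\ (alpha (o4 0) : {mpoly int[4]}) \is 2.-homog,
      (alpha (o4 1) : {mpoly int[4]}) \is 3.-homog,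
      (alpha (o4 2) : {mpoly int[4]}) \is 4.-homog
    & (alpha (o4 3) : {mpoly int[4]}) \is 6.-homog].
Proof.
case: invs_sigmas => E0 E1 E2 E3; split.
- by rewrite /= E0; apply: rpredB; homog_monomial.
- by rewrite /= E1; apply: rpredD; [apply: rpredB|]; homog_monomial.
- rewrite /= E2; apply: rpredB; last homog_monomial.
  by do 2?[apply: rpredD]; [apply: rpredB| |]; homog_monomial.
- rewrite /= E3; apply: rpredB; last homog_monomial.
  by do 2?[apply: rpredD]; [apply: rpredB| |]; homog_monomial.
Qed.

Theorem theorem2p2 :
  exists alpha2 alpha3 alpha4 alpha6 : K4,
    [/\ (alpha2 : {mpoly int[4]}) \is 2.-homog,
        (alpha3 : {mpoly int[4]}) \is 3.-homog,
        (alpha4 : {mpoly int[4]}) \is 4.-homog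
      & (alpha6 : {mpoly int[4]}) \is 6.-homog]
  /\ (forall y : K4, exists p : {mpoly int[4]},
        evalK4 alpha2 alpha3 alpha4 alpha6 p = y)
  /\ (forall p : {mpoly int[4]},
        evalK4 alpha2 alpha3 alpha4 alpha6 p = 0 <->
        exists q : {mpoly int[4]},
          p = q * (64%:R * a6 - 97%:R * a2 ^+ 3 - 27%:R * a3 ^+ 2
                   + 144%:R * a2 * a4)).
Proof.
exists (alpha (o4 0)), (alpha (o4 1)), (alpha (o4 2)), (alpha (o4 3)).
split; first exact: alpha_homog.
split=> [y|p].
  have [p [pE _]] := sym_fundamental (Lambda4_sym (K4_val y)).
  have [|r Er] := @ker_nabla_invs p.
    by apply/eqP; rewrite pE -ker_nablaE; exact: K4_ker.
  exists r; do 2 apply: val_inj; rewrite evalK4_alpha -Er; exact: pE.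
split=> [p0|[q ->]].
  by apply/invs_ker/msym_fundamental_un0; rewrite -[LHS]evalK4_alpha p0.
have qsyz0 : (q * syz) \mPo invs = 0.
  by rewrite (rmorphM (comp_mpoly invs)) /= syz_invs mulr0.
by do 2 apply: val_inj; rewrite evalK4_alpha [X in X \mPo _]qsyz0 comp_mpoly0.
Qed.
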